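(* Let $(X,m)$ be a $\sigma$-finite measure space, $1\le p<\infty$, $\gamma\ne0$, and $\{T_t:t>0\}$ a one-parameter family of (not necessarily linear) operators on $L^p(X,m)$; let $f\in L^p(X,m)$ with $(x,t)\mapsto T_tf(x)$ measurable. Put $L=\infty$ if $\gamma>0$ and $L=0$ if $\gamma<0$, and for $\lambda>0$ $$J(\lambda)=\lambda^p\iint_{\{(x,t)\in X\times(0,\infty):\,t^{-\gamma/p}|T_tf(x)|>\lambda\}}t^{\gamma-1}\,dt\,dm(x).$$ (i) If $T^*f:=\sup_{t>0}|T_tf|\in L^p(X,m)$, then $\sup_{\lambda>0}J(\lambda)\le\frac1{|\gamma|}\|T^*f\|_{L^p(X,m)}^p$. If, in addition, $g(x)=\lim_{t\to0+}T_tf(x)$ exists and is finite for $m$-a.e. $x$, then $\lim_{\lambda\to L}J(\lambda)$ exists and equals $\frac1{|\gamma|}\|g\|_{L^p(X,m)}^p$. (ii) If $g(x)=\lim_{t\to0+}T_tf(x)$ exists and is finite for $m$-a.e. $x$, then $\frac1{|\gamma|}\|g\|_{L^p(X,m)}^p\le\liminf_{\lambda\to L}J(\lambda)$. *)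

(* Defs.v *)
From HB Require Import structures.
From mathcomp Require Import all_boot all_order all_algebra.
From mathcomp Require Import all_classical all_reals all_analysis.
From mathcomp Require Import measurable_realfun.
Set Implicit Arguments. Unset Strict Implicit. Unset Printing Implicit Defensive.
Import Order.TTheory GRing.Theory Num.Def Num.Theory.
Import numFieldNormedType.Exports.
Local Open Scope classical_set_scope.
Local Open Scope ring_scope.

Definition Tstar {X : Type} {R' : realType} (T : R' -> (X -> R') -> X -> R')
  (f : X -> R') (x : X) : \bar R' :=
  ereal_sup [set (`|T t f x|)%:E | t in `]0, +oo[%classic].

Definition Jfun {d} {X : measurableType d} {R : realType}
  (m : {measure set X -> \bar R}) (p gamma : R)
  (T : R -> (X -> R) -> X -> R) (f : X -> R) (lam : R) : \bar R :=
  ((powR lam p)%:E *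
   \int[m]_x \int[lebesgue_measure]_(t in
        [set t : R | (0 < t)%R /\ (lam < powR t (- (gamma / p)) * `|T t f x|)%R])
        (powR t (gamma - 1))%:E)%E.

Definition inLp {d} {X : measurableType d} {R : realType}
  (m : {measure set X -> \bar R}) (p : R) (f : X -> R) : Prop :=
  measurable_fun setT f /\ (\int[m]_x (powR `|f x| p)%:E < +oo)%E.

(* Main.v *)
Require Import Defs.
From HB Require Import structures.
From mathcomp Require Import all_boot all_order all_algebra.
From mathcomp Require Import all_classical all_reals all_analysis.
From mathcomp Require Import measurable_realfun zify ring.
Set Implicit Arguments. Unset Strict Implicit. Unset Printing Implicit Defensive.
Import Order.TTheory GRing.Theory Num.Def Num.Theory.
Import numFieldNormedType.Exports.
Local Open Scope classical_set_scope.
Local Open Scope ring_scope.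

(** With [c = lambda^p] and [psi t = |T_t f x|^p], the condition
    [t^(-gamma/p) |T_t f x| > lambda] reads [c t^gamma < psi t], so that
    [J lambda] is the integral over [x] of the layer mass
    [c * \int_{t > 0, c t^gamma < psi t} t^(gamma-1) dt].  For constant [psi] the
    layer mass is exactly [psi / |gamma|], whatever [c]; by monotonicity in [psi] it
    is at most [(T^* f x)^p / |gamma|].  As [lambda -> L], times bounded away from 0
    stop contributing, so only the limit of [psi] at [0+] matters and the layer mass
    tends to [|g x|^p / |gamma|].  Dominated convergence and Fatou's lemma, applied
    along sequences [lambda_n -> L], give (i) and (ii). *)

(** * Integrals of [t ^ (g - 1)] over intervals and sublevel sets *)

Section power_integrals.
Context {R : realType}.
Implicit Types a b c g t : R.
Notation mu := (@lebesgue_measure R).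

Lemma is_derive_powR_primitive g t : g != 0 -> 0 < t ->
  is_derive t 1 (fun s : R => g^-1 * s `^ g) (t `^ (g - 1)).
Proof.
move=> g0 t0.
have D := is_derive1_powR g t0.
have := @is_deriveZ R R R (fun x : R => x `^ g) g^-1 t 1 _ D.
by rewrite /GRing.scale /= mulrA mulVf// mul1r.
Qed.

Lemma continuous_powR_gt0 g t : 0 < t -> {for t, continuous (fun x : R => x `^ g)}.
Proof.
move=> t0; apply/differentiable_continuous/derivable1_diffP.
by have [] := is_derive1_powR g t0.
Qed.

Lemma integral_powR_itvcc g a b : g != 0 -> 0 < a -> a < b ->
  (\int[mu]_(t in `[a, b]) (t `^ (g - 1))%:E = (g^-1 * (b `^ g - a `^ g))%:E)%E.
Proof.
move=> g0 a0 ab; rewrite mulrBr EFinB.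
have D t : a <= t -> is_derive t 1 (fun s : R => g^-1 * s `^ g) (t `^ (g - 1)).
  by move=> at_; apply: is_derive_powR_primitive => //; exact: lt_le_trans at_.
have dF t : a <= t -> derivable (fun s : R => g^-1 * s `^ g) t 1.
  by move=> /D[].
have cF : {within `[a, b], continuous (fun s : R => g^-1 * s `^ g)}.
  apply: derivable_within_continuous => t; rewrite in_itv/= => /andP[? _].
  exact: dF.
apply: (@continuous_FTC2 _ _ (fun s : R => g^-1 * s `^ g)) => //.
- apply: derivable_within_continuous => t; rewrite in_itv/= => /andP[at_ _].
  by have [] := is_derive1_powR (g - 1) (lt_le_trans a0 at_).
- move/(continuous_within_itvP _ ab): cF => [_ ? ?]; split => //.
  by move=> t; rewrite in_itv/= => /andP[/ltW ? _]; exact: dF.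
- by move=> t; rewrite in_itv/= => /andP[/ltW ? _]; rewrite derive1E; have [] := D t.
Qed.

Lemma measurable_EFin_powR g (D : set R) :
  measurable_fun D (fun t : R => (t `^ g)%:E).
Proof.
by apply/measurable_EFinP; apply: measurable_funTS; exact: measurable_powR.
Qed.

Lemma powR_neg_cvg0 g : g < 0 -> t `^ g @[t --> +oo] --> 0.
Proof.
move=> g0; apply/cvgrPdist_le => e e0; near=> t.
have t0 : 0 < t by near: t; exact: nbhs_pinfty_gt.
rewrite sub0r normrN ger0_norm ?powR_ge0//.
rewrite -(opprK g) powRN -[leRHS]invrK lef_pV2 ?posrE ?powR_gt0 ?invr_gt0//.
have -> : e^-1 = (e^-1 `^ (- g)^-1) `^ (- g).
  by rewrite -powRrM mulVf ?powRr1 ?invr_ge0 ?ltW// oppr_eq0 lt_eqF.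
have H : e^-1 `^ (- g)^-1 <= t by near: t; exact: nbhs_pinfty_ge.
by apply: ge0_ler_powR => //; rewrite ?oppr_ge0 ?nnegrE ?powR_ge0// ltW.
Unshelve. all: end_near. Qed.

Lemma integral_powR_itvcy g b : g < 0 -> 0 < b ->
  (\int[mu]_(t in `[b, +oo[) (t `^ (g - 1))%:E = (`|g|^-1 * b `^ g)%:E)%E.
Proof.
move=> g0 b0; have gn0 : g != 0 by rewrite lt_eqF.
have D t : b <= t -> is_derive t 1 (fun s : R => g^-1 * s `^ g) (t `^ (g - 1)).
  by move=> bt; apply: is_derive_powR_primitive => //; exact: lt_le_trans bt.
rewrite (@ge0_continuous_FTC2y _ _ (fun s : R => g^-1 * s `^ g) b 0).
- by rewrite -EFinB sub0r ltr0_norm// invrN mulNr.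
- by move=> *; exact: powR_ge0.
- apply: derivable_within_continuous => t; rewrite in_itv/= andbT => bt.
  by have [] := is_derive1_powR (g - 1) (lt_le_trans b0 bt).
- by rewrite -[0](mulr0 g^-1); apply: cvgM; [exact: cvg_cst|exact: powR_neg_cvg0].
- by move=> t /ltW /D [].
- apply: cvg_at_right_filter.
  by apply: cvgM; [exact: cvg_cst|exact: continuous_powR_gt0].
- by move=> t; rewrite in_itv/= andbT => /ltW ?; rewrite derive1E; have [] := D t.
Qed.

(** For [g < 1] the integrand blows up at 0, so the integral is taken over compact intervals
    exhausting []0, b]], where the fundamental theorem of calculus applies, and monotone convergence
    passes to the union. *)
Lemma integral_powR_itvoc0 g b : 0 < g -> 0 < b ->
  (\int[mu]_(t in `]0%R, b]) (t `^ (g - 1))%:E = (g^-1 * b `^ g)%:E)%E.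
Proof.
move=> g0 b0; have gn0 : g != 0 by rewrite gt_eqF.
(* The shift to [n + 2] keeps [a n < b] strict even at [n = 0]. *)
pose a (n : nat) := b * n.+2%:R^-1.
have a0 n : 0 < a n by rewrite mulr_gt0// invr_gt0.
have ab n : a n < b.
  by rewrite /a -[ltRHS]mulr1 ltr_pM2l// invf_lt1// ltr1n.
have -> : `]0%R, b]%classic = \bigcup_n `[a n, b]%classic.
  apply/seteqP; split => t /=; rewrite in_itv/=.
  - move=> /andP[t0 tb].
    have [n bt] : exists n : nat, b / t < n%:R.
      by exists (Num.bound (b / t)); apply: archi_boundP; rewrite divr_ge0// ltW.
    exists n => //=; rewrite in_itv/= tb andbT /a ler_pdivrMr// mulrC.
    rewrite -ler_pdivrMr// (le_trans (ltW bt))// ler_nat; lia.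
  - move=> [n _ /=]; rewrite in_itv/= => /andP[an ->]; rewrite andbT.
    exact: lt_le_trans an.
have cv : (\int[mu]_(t in `[a n, b]) (t `^ (g - 1))%:E @[n --> \oo] -->
    \int[mu]_(t in \bigcup_n `[a n, b]%classic) (t `^ (g - 1))%:E)%E.
  apply: ge0_nondecreasing_set_cvg_integral => //=.
  - move=> m n mn; apply/subsetPset => t /=; rewrite !in_itv/= => /andP[am ->].
    rewrite andbT (le_trans _ am)// /a ler_pM2l// lef_pV2 ?posrE// ler_nat; lia.
  - by move=> n; exact: measurable_EFin_powR.
  - by move=> n t _; rewrite lee_fin powR_ge0.
apply: (cvg_unique _ cv) => //=.
rewrite (_ : (fun n => _) = (fun n => (g^-1 * (b `^ g - a n `^ g))%:E)); last first.
  by apply/funext => n; rewrite integral_powR_itvcc.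
apply/fine_cvgP; split; first exact: nearW.
rewrite /comp/= -[X in _ --> X](_ : g^-1 * (b `^ g - 0) = _); last by rewrite subr0.
apply: cvgM; first exact: cvg_cst.
apply: cvgB; first exact: cvg_cst.
have /cvg_at_rightP := powR_cvg0 g0; apply; split => //.
rewrite -[X in _ --> X](mulr0 b); apply: cvgM; first exact: cvg_cst.
have := @cvg_harmonic R.
by rewrite -(cvg_shiftS (@harmonic R)).
Qed.

(** The set ends at the crossing point [b] with [b ^ g = A]: it is []0, b[] when [g > 0] and []b,
    +oo[] when [g < 0]. In both cases the primitive contributes [b ^ g / |g|], so the sign of [g]
    survives only in the absolute value. *)
Lemma integral_powR_sublevel g (A : R) : g != 0 -> 0 <= A ->
  (\int[mu]_(t in [set t : R | (0 < t /\ t `^ g < A)%R]) (t `^ (g - 1))%:E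
   = (`|g|^-1 * A)%:E)%E.
Proof.
move=> g0; rewrite le_eqVlt => /predU1P[<-|A0].
  rewrite mulr0 (_ : [set _ | _] = set0) ?integral_set0//.
  by apply/seteqP; split => t //= [_]; rewrite ltNge powR_ge0.
pose b := A `^ g^-1.
have b0 : 0 < b by exact: powR_gt0.
have bg : b `^ g = A by rewrite /b -powRrM mulVf// powRr1// ltW.
(* Here [gp] is [g < 0] and [gn] is [0 < g]; the positive case is treated first. *)
have [gp|gn] := orP (lt_total g0); last first.
  rewrite -bg gtr0_norm// -integral_powR_itvoc0//.
  rewrite -integral_itv_bndo_bndc; last exact: measurable_EFin_powR.
  congr (integral _ _ _); apply/seteqP; split => t /=; rewrite in_itv/=.
    move=> [t0]; rewrite t0/=; apply: contraTT; rewrite -!leNgt => bt.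
    by rewrite ge0_ler_powR// ?nnegrE ?ltW.
  move=> /andP[t0 tb]; split => //.
  by rewrite gt0_ltr_powR// ?nnegrE ?ltW.
rewrite -bg -integral_powR_itvcy//.
rewrite -integral_itv_obnd_cbnd; last exact: measurable_EFin_powR.
(* Reciprocals reduce the decreasing power to the increasing power of exponent [- g]. *)
have inv x : x `^ g = (x `^ (- g))^-1 by rewrite -powRN opprK.
congr (integral _ _ _); apply/seteqP; split => t /=; rewrite in_itv/= andbT.
  move=> [t0]; rewrite !inv ltf_pV2 ?posrE ?powR_gt0//.
  apply: contraTT; rewrite -!leNgt => tb.
  by rewrite ge0_ler_powR// ?nnegrE ?ltW ?oppr_gt0.
move=> bt; have t0 := lt_trans b0 bt; split => //.
rewrite !inv ltf_pV2 ?posrE ?powR_gt0//.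
by rewrite gt0_ltr_powR// ?nnegrE ?ltW ?oppr_gt0.
Qed.

End power_integrals.

(** * Layer masses and their limits at the end of the parameter range *)

Definition powR_layer {R : realType} (g c : R) (psi : R -> R) : set R :=
  [set t | 0 < t /\ c * t `^ g < psi t].

Definition layer_mass {R : realType} (g c : R) (psi : R -> R) : \bar R :=
  (c%:E * \int[lebesgue_measure]_(t in powR_layer g c psi) (t `^ (g - 1))%:E)%E.

(** This encodes the limit towards $L$: one filter covers both signs of the exponent, and at [gamma]
    it is convertible to [Lfilt] in the theorem. *)
Definition end_filter {R : realType} (g : R) : set_system R :=
  if 0 < g then +oo%R else 0^'+.

#[global] Instance end_filter_proper {R : realType} (g : R) :
  ProperFilter (end_filter g).
Proof. by rewrite /end_filter; case: ifP => _; exact _. Qed.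

Section layer_mass.
Context {R : realType}.
Implicit Types (g c : R) (psi phi : R -> R).
Notation mu := (@lebesgue_measure R).

Lemma end_filter_gt0 g : \forall c \near end_filter g, 0 < c.
Proof.
rewrite /end_filter; case: ifP => _; first exact: nbhs_pinfty_gt.
exact: nbhs_right_gt.
Qed.

Lemma measurable_powR_layer g c psi : measurable_fun (`]0, +oo[%classic : set R) psi ->
  measurable (powR_layer g c psi).
Proof.
move=> mpsi.
have mt : measurable_fun (`]0, +oo[%classic : set R) (fun t : R => c * t `^ g).
  by apply: measurable_funM => //; apply: measurable_funTS; exact: measurable_powR.
have := @measurable_fun_ltr _ _ R _ _ _ mt mpsi.
move=> /(_ (measurable_itv _) [set true] I).
congr measurable; apply/seteqP; split => t /=; rewrite in_itv/= andbT.
  by [].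
by [].
Qed.

Lemma layer_mass_ge0 g c psi : 0 <= c -> (0 <= layer_mass g c psi)%E.
Proof.
move=> c0; rewrite mule_ge0// integral_ge0// => t _.
by rewrite lee_fin powR_ge0.
Qed.

Lemma le_layer_mass g c psi phi : 0 <= c ->
  measurable_fun (`]0, +oo[%classic : set R) psi -> measurable_fun (`]0, +oo[%classic : set R) phi ->
  powR_layer g c psi `<=` powR_layer g c phi ->
  (layer_mass g c psi <= layer_mass g c phi)%E.
Proof.
move=> c0 mpsi mphi sub; apply: lee_wpmul2l => //.
apply: ge0_subset_integral => //; try exact: measurable_powR_layer.
  exact: measurable_EFin_powR.
by move=> t _; rewrite lee_fin powR_ge0.
Qed.

(** The layer is the sublevel set at height [A / c], and the prefactor [c] cancels this scaling. *)
Lemma layer_mass_cst g c A : g != 0 -> 0 < c -> 0 <= A ->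
  layer_mass g c (cst A) = (`|g|^-1 * A)%:E.
Proof.
move=> g0 c0 A0; rewrite /layer_mass.
have -> : powR_layer g c (cst A) = [set t | 0 < t /\ t `^ g < A / c].
  by apply/seteqP; split => t [t0 /=]; rewrite ltr_pdivlMr// mulrC.
rewrite integral_powR_sublevel//; last by rewrite divr_ge0// ltW.
rewrite -EFinM; congr EFin.
by field; rewrite normr_eq0 g0 gt_eqF.
Qed.

Lemma layer_mass_le_cst g c psi A : g != 0 -> 0 < c -> 0 <= A ->
  measurable_fun (`]0, +oo[%classic : set R) psi -> (forall t, 0 < t -> psi t <= A) ->
  (layer_mass g c psi <= (`|g|^-1 * A)%:E)%E.
Proof.
move=> g0 c0 A0 mpsi psiA; rewrite -(layer_mass_cst g0 c0 A0).
apply: le_layer_mass => //; first exact: ltW.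
by move=> t [t0 ct]; split => //; exact: lt_le_trans ct (psiA _ t0).
Qed.

(* For times bounded below, the layer condition eventually either fails
   ([g > 0], [c] large) or holds with an arbitrarily small threshold
   ([g < 0], [c] small). *)
Lemma end_filter_tail g t0 M e : g != 0 -> 0 < t0 -> 0 < e ->
  \forall c \near end_filter g,
    forall t, t0 <= t -> c * t `^ g < M -> c * t `^ g < e.
Proof.
move=> gn0 t00 e0; have tg0 := powR_gt0 g t00.
rewrite /end_filter; case: ifPn => [g0|]; last first.
  rewrite -leNgt le_eqVlt (negbTE gn0)/= => g0.
  near=> c => t tt _.
  have c0 : 0 < c by near: c; exact: nbhs_right_gt.
  apply: (@le_lt_trans _ _ (c * t0 `^ g)).
    rewrite ler_pM2l// -(opprK g) !(powRN _ (- g)).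
    rewrite lef_pV2 ?posrE ?powR_gt0 ?(lt_le_trans t00)//.
    by apply: ge0_ler_powR; rewrite ?oppr_ge0 ?nnegrE// ltW// (lt_le_trans t00).
  rewrite -ltr_pdivlMr//.
  by near: c; apply: nbhs_right_lt; rewrite divr_gt0.
near=> c => t tt cM; exfalso; move: cM; apply/negP; rewrite -leNgt.
have c0 : 0 < c by near: c; exact: nbhs_pinfty_gt.
apply: (@le_trans _ _ (c * t0 `^ g)).
  by rewrite -ler_pdivrMr//; near: c; exact: nbhs_pinfty_ge.
rewrite ler_pM2l//.
by apply: ge0_ler_powR; rewrite ?nnegrE// ltW// (lt_le_trans t00).
Unshelve. all: end_near. Qed.

Lemma near_at_right0 (P : R -> Prop) : (\forall t \near 0^'+, P t) ->
  exists2 t0 : R, 0 < t0 & forall t, 0 < t -> t < t0 -> P t.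
Proof.
move=> [d /= d0 H]; exists d => // t t0 td; apply: H => //=.
by rewrite sub0r normrN gtr0_norm.
Qed.

(** The layer of [psi] ends up inside that of the constant [B]: before [t0] because [psi <= B],
    after [t0] because [psi <= M] forces [c * t ^ g < M], which [end_filter_tail] improves to
    [< B]. *)
Lemma layer_mass_near_le g psi M B : g != 0 ->
  measurable_fun (`]0, +oo[%classic : set R) psi -> (forall t, 0 < t -> psi t <= M) ->
  0 < B -> (\forall t \near 0^'+, psi t <= B) ->
  \forall c \near end_filter g, (layer_mass g c psi <= (`|g|^-1 * B)%:E)%E.
Proof.
move=> g0 mpsi psiM B0 /near_at_right0[t0 t00 psiB]; near=> c.
have c0 : 0 < c by near: c; exact: end_filter_gt0.
have tail : forall t, t0 <= t -> c * t `^ g < M -> c * t `^ g < B.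
  by near: c; exact: end_filter_tail.
rewrite -(layer_mass_cst g0 c0 (ltW B0)); apply: le_layer_mass => //.
  exact: ltW.
move=> t [tgt0 ct]; split => //=.
have [tt|tt] := ltP t t0; first exact/(lt_le_trans ct)/psiB.
by apply: tail => //; exact/(lt_le_trans ct)/psiM.
Unshelve. all: end_near. Qed.

(** The layer of the constant [B] is covered by the layer of [psi] (times before [t0]) and the layer
    of the constant [e] (times after [t0], by [end_filter_tail]); subadditivity gives the bound. *)
Lemma layer_mass_near_ge g psi B e : g != 0 ->
  measurable_fun (`]0, +oo[%classic : set R) psi ->
  0 <= B -> 0 < e -> (\forall t \near 0^'+, B <= psi t) ->
  \forall c \near end_filter g,
    ((`|g|^-1 * B)%:E <= layer_mass g c psi + (`|g|^-1 * e)%:E)%E.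
Proof.
move=> g0 mpsi B0 e0 /near_at_right0[t0 t00 psiB]; near=> c.
have c0 : 0 < c by near: c; exact: end_filter_gt0.
have tail : forall t, t0 <= t -> c * t `^ g < B -> c * t `^ g < e.
  by near: c; exact: end_filter_tail.
rewrite -(layer_mass_cst g0 c0 B0) -(layer_mass_cst g0 c0 (ltW e0)).
have ml phi := @measurable_powR_layer g c phi.
have f0 t : (0 <= (t `^ (g - 1))%:E)%E by rewrite lee_fin powR_ge0.
have ie0 (D : set R) : (0 <= \int[mu]_(t in D) (t `^ (g - 1))%:E)%E.
  by apply: integral_ge0.
rewrite /layer_mass -ge0_muleDr//; apply: lee_wpmul2l; first by rewrite lee_fin ltW.
set U := powR_layer g c psi; set V := powR_layer g c (cst e).
have mU : measurable U by exact: ml.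
have mV : measurable V by exact: ml.
apply: (@le_trans _ _ (\int[mu]_(t in U `|` V) (t `^ (g - 1))%:E)%E).
  apply: ge0_subset_integral => //.
  - exact: ml.
  - exact: measurableU.
  - exact: measurable_EFin_powR.
  move=> t [tgt0 /= ct]; have [tt|tt] := ltP t t0.
    by left; split => //; exact/(lt_le_trans ct)/psiB.
  by right; split => //; exact: tail.
(* Splitting the union as [U] plus its complement in the union makes it disjoint; the second piece
   lies in [V]. *)
rewrite -(setDUK (@subsetUl _ U V)) ge0_integral_setU//; last 3 first.
- by apply: measurableD => //; exact: measurableU.
- exact: measurable_EFin_powR.
- by rewrite disj_set2E setDIK.
apply: leeD2l; apply: ge0_subset_integral => //.
- by apply: measurableD => //; exact: measurableU.
- exact: measurable_EFin_powR.
- by move=> t [[]].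
Unshelve. all: end_near. Qed.

(** The lower half of the limit asks for no upper bound on [psi], which is what lets (ii) hold
    without control of the maximal function. *)
Lemma layer_mass_cvg_ge g psi G e : g != 0 ->
  measurable_fun (`]0, +oo[%classic : set R) psi ->
  (forall t, 0 < t -> 0 <= psi t) -> psi t @[t --> 0^'+] --> G -> 0 < e ->
  \forall c \near end_filter g, ((`|g|^-1 * G - e)%:E <= layer_mass g c psi)%E.
Proof.
move=> g0 mpsi psi0 /cvgrPdist_le psiG e0.
have k0 : 0 < `|g| by rewrite normr_gt0.
(* An amount [d] is lost twice, once from [psi] being only close to [G] and once from the tail;
   after division by [|g|] each costs [e / 2]. *)
pose d := `|g| * (e / 2); have d0 : 0 < d by rewrite mulr_gt0// divr_gt0.
(* Truncation at 0 is needed since [layer_mass_near_ge] takes a nonnegative level. *)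
have near_psi : \forall t \near 0^'+, maxr 0 (G - d) <= psi t.
  near=> t; rewrite ge_max psi0 /=; last by near: t; exact: nbhs_right_gt.
  have : `|G - psi t| <= d by near: t; exact: psiG.
  by rewrite ler_distlC => /andP[].
have B0 : 0 <= maxr 0 (G - d) by rewrite le_max lexx.
have := layer_mass_near_ge g0 mpsi B0 d0 near_psi.
apply: filterS => c; rewrite -leeBlDr// -EFinB; apply: le_trans.
rewrite lee_fin -mulrBr.
have -> : `|g|^-1 * G - e = `|g|^-1 * (G - d - d).
  by rewrite /d; field; rewrite gt_eqF.
by rewrite ler_pM2l ?invr_gt0// lerD2r le_max lexx orbT.
Unshelve. all: end_near. Qed.

(** A squeeze between the two one-sided estimates; the bound [M] enters through the upper one, to
    control times away from 0. *)
Lemma layer_mass_cvg g psi G M : g != 0 ->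
  measurable_fun (`]0, +oo[%classic : set R) psi ->
  (forall t, 0 < t -> 0 <= psi t <= M) -> psi t @[t --> 0^'+] --> G ->
  layer_mass g c psi @[c --> end_filter g] --> (`|g|^-1 * G)%:E.
Proof.
move=> g0 mpsi psi0M psiG.
have k0 : 0 < `|g| by rewrite normr_gt0.
have psi0 t : 0 < t -> 0 <= psi t by move=> /psi0M /andP[].
have psiM t : 0 < t -> psi t <= M by move=> /psi0M /andP[].
have G0 : 0 <= G.
  apply: (cvgr_to_ge psiG); near=> t; apply: psi0.
  by near: t; exact: nbhs_right_gt.
have bounds e : 0 < e -> \forall c \near end_filter g,
    ((`|g|^-1 * G - e)%:E <= layer_mass g c psi <= (`|g|^-1 * G + e)%:E)%E.
  move=> e0; pose d := `|g| * e; have d0 : 0 < d by rewrite mulr_gt0.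
  near=> c; apply/andP; split; first by near: c; exact: layer_mass_cvg_ge.
  have -> : `|g|^-1 * G + e = `|g|^-1 * (G + d).
    by rewrite /d; field; rewrite gt_eqF.
  near: c; apply: (@layer_mass_near_le _ _ M) => //; first by rewrite ltr_wpDl.
  move/cvgrPdist_le : psiG => /(_ _ d0); apply: filterS => t.
  by rewrite ler_distlC => /andP[].
apply/fine_cvgP; split.
  apply: filterS (bounds 1 ltr01) => c /andP[lo hi].
  by rewrite fin_numE gt_eqF ?lt_eqF// ?(le_lt_trans hi) ?ltry//
    (lt_le_trans _ lo)// ltNyr.
apply/cvgrPdist_le => e e0; apply: filterS (bounds e e0) => c /=.
by case: layer_mass => [r| |]; rewrite ?lee_fin ?leye_eq ?leeNy_eq ?andbF// ler_distlC.
Unshelve. all: end_near. Qed.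

End layer_mass.

(** * Translating levels and limits into [p]-th powers *)

Section real_powers.
Context {R : realType}.
Implicit Types (p x y : R).

Lemma ltr_powR2r p x y : 0 < p -> 0 <= x -> 0 <= y ->
  (x `^ p < y `^ p) = (x < y).
Proof.
move=> p0 x0 y0; apply/idP/idP; last by move=> ?; rewrite gt0_ltr_powR.
by apply: contraTT; rewrite -!leNgt => yx; apply: ge0_ler_powR => //; exact: ltW.
Qed.

Lemma weighted_level_powR p g lam t y : 0 < p -> 0 < lam -> 0 < t -> 0 <= y ->
  (lam < t `^ (- (g / p)) * y) = (lam `^ p * t `^ g < y `^ p).
Proof.
move=> p0 lam0 t0 y0; have tgp := powR_gt0 (g / p) t0.
have -> : t `^ g = (t `^ (g / p)) `^ p by rewrite -powRrM divfK// gt_eqF.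
rewrite -powRM ?ltW// ltr_powR2r// ?mulr_ge0 ?ltW//.
by rewrite powRN mulrC ltr_pdivlMr.
Qed.

(** For [l > 0] this is continuity of the power; at [l = 0] it is checked directly, with threshold
    [e ^ (1 / p)]. *)
Lemma cvg_powR_ge0 {I : Type} {F : set_system I} {FF : ProperFilter F}
    (a : I -> R) l p : 0 < p -> (forall i, 0 <= a i) ->
  a i @[i --> F] --> l -> a i `^ p @[i --> F] --> l `^ p.
Proof.
move=> p0 a0 al.
have : 0 <= l by apply: (cvgr_to_ge al); exact: nearW.
rewrite le_eqVlt => /predU1P[l0|l0]; last first.
  exact: (cvg_comp _ _ al (continuous_powR_gt0 l0)).
move: al; rewrite -l0 powR0 ?gt_eqF// => /cvgrPdist_lt al.
apply/cvgrPdist_lt => e e0.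
apply: filterS (al _ (powR_gt0 p^-1 e0)) => i.
rewrite !sub0r !normrN !ger0_norm ?powR_ge0//.
rewrite -(ltr_powR2r p0) ?powR_ge0// -powRrM mulVf ?gt_eqF// powRr1//.
exact: ltW.
Qed.

End real_powers.

(** * Reducing limits along the end filter to sequences *)

Lemma lte_dense {R : realType} (x y : \bar R) : (x < y)%E ->
  exists2 z, (x < z)%E & (z < y)%E.
Proof.
case: x y => [x| |] [y| |]//; rewrite ?lte_fin.
- by exists ((x + y) / 2)%:E; rewrite lte_fin ?midf_lt.
- by exists (x + 1)%:E; rewrite ?ltry// lte_fin ltrDl.
- by exists (y - 1)%:E; rewrite ?ltNyr// lte_fin ltrBlDr ltrDl.
- by exists 0%:E; rewrite ?ltNyr ?ltry.
Qed.

Section end_filter_sequences.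
Context {R : realType}.
Implicit Types (g p : R).

Lemma cvg_powR_end_filter g p : 0 < p ->
  lam `^ p @[lam --> end_filter g] --> end_filter g.
Proof.
move=> p0; rewrite /end_filter; case: ifP => _.
  apply/cvgryPge => A; near=> lam.
  (* The 1 ensures [lam > 0], as monotonicity of the power requires. *)
  have lam1 : maxr 1 (A `^ p^-1) <= lam by near: lam; exact: nbhs_pinfty_ge.
  move: lam1; rewrite ge_max => /andP[lam1 Alam].
  have [A0|A0] := leP A 0; first exact: le_trans (powR_ge0 _ _).
  have <- : (A `^ p^-1) `^ p = A by rewrite -powRrM mulVf ?gt_eqF// powRr1// ltW.
  apply: ge0_ler_powR; rewrite ?nnegrE ?powR_ge0//; exact: ltW.
move=> V [e /= e0 eV].
change (\forall lam \near 0^'+, V (lam `^ p)); near=> lam.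
have lam0 : 0 < lam by near: lam; exact: nbhs_right_gt.
apply: eV => /=; last exact: powR_gt0.
rewrite sub0r normrN ger0_norm ?powR_ge0//.
have <- : (e `^ p^-1) `^ p = e by rewrite -powRrM mulVf ?gt_eqF// powRr1// ltW.
rewrite (ltr_powR2r p0 (ltW lam0)) ?powR_ge0//.
by near: lam; apply: nbhs_right_lt; exact: powR_gt0.
Unshelve. all: end_near. Qed.

(** The filter has a countable base, so a set meeting all its members contains a sequence converging
    along it: choose points beyond [n], respectively in []0, 1 / (n + 1)[]. *)
Lemma end_filter_frequently_seq g (V : set R) :
  (forall B, end_filter g B -> exists2 x, B x & V x) ->
  exists u : nat -> R, [/\ u n @[n --> \oo] --> end_filter g,
    forall n, 0 < u n & forall n, V (u n)].
Proof.
rewrite /end_filter; case: ifP => _ FV.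
  have /choice[u uP] : forall n : nat, exists x : R, n%:R < x /\ V x.
    move=> n; have [|x nx Vx] := FV [set x | n%:R < x]; last by exists x.
    exact: nbhs_pinfty_gt.
  exists u; split => [|n|n]; last by have [] := uP n.
    apply/cvgryPge => A; near=> n.
    have [/ltW nu _] := uP n; apply: le_trans nu.
    by near: n; exact: nbhs_infty_ger.
  by have [nu _] := uP n; exact: le_lt_trans nu.
have /choice[u uP] : forall n : nat, exists x : R, [/\ 0 < x, x < n.+1%:R^-1 & V x].
  move=> n; have [|x [x0 xn] Vx] := FV [set x | 0 < x /\ x < n.+1%:R^-1]; last by exists x.
  near=> x; split; first by near: x; exact: nbhs_right_gt.
  by near: x; apply: nbhs_right_lt; rewrite invr_gt0.
exists u; split => [|n|n]; [|by have [] := uP n|by have [] := uP n].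
move=> W [e /= e0 eW].
change (\forall n \near \oo, W (u n)); near=> n; have [u0 un _] := uP n.
apply: eW => //=; rewrite sub0r normrN gtr0_norm//; apply: lt_trans un _.
near: n; have /cvgrPdist_lt/(_ _ e0) := @cvg_harmonic R.
by apply: filterS => n; rewrite sub0r normrN ger0_norm// invr_ge0.
Unshelve. all: end_near. Qed.

Lemma cvg_end_filter_seq g (J : R -> \bar R) (l : \bar R) :
  (forall u : nat -> R, u n @[n --> \oo] --> end_filter g ->
    (forall n, 0 < u n) -> J (u n) @[n --> \oo] --> l) ->
  J x @[x --> end_filter g] --> l.
Proof.
move=> seqJ W Wl; apply: contrapT => nW.
have [|u [ug u0 uW]] := @end_filter_frequently_seq g (~` (J @^-1` W)).
  move=> B FB; apply: contrapT => nB; apply: nW.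
  apply: filterS FB => x Bx; apply: contrapT => Wx.
  by apply: nB; exists x.
by have /(_ _ Wl)[n _ /(_ n (leqnn n))] := seqJ u ug u0; exact: uW.
Qed.

(** Otherwise some [r] lies strictly between the lower limit and [l]. The infimum of [J] over every
    member of the filter is then below [r], so a sequence with [J < r] exists, and its lower limit
    is at most [r < l]. *)
Lemma limf_einf_end_filter_seq g (J : R -> \bar R) (l : \bar R) :
  (forall u : nat -> R, u n @[n --> \oo] --> end_filter g ->
    (forall n, 0 < u n) -> (l <= limn_einf (J \o u))%E) ->
  (l <= limf_einf J (end_filter g))%E.
Proof.
move=> seqJ; rewrite leNgt; apply/negP => /lte_dense[r Jr rl].
have [|u [ug u0 uV]] := @end_filter_frequently_seq g [set x | (J x < r)%E].
  move=> B FB; have /ereal_inf_lt[_ [x Bx <-] Jxr] : (ereal_inf (J @` B) < r)%E.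
    apply: le_lt_trans Jr; rewrite limf_einfE; apply: ereal_sup_ubound.
    by exists B.
  by exists x.
have : (limn_einf (J \o u) <= r)%E.
  rewrite limn_einf_lim; apply: lime_le; first exact: is_cvg_einfs.
  apply: nearW => n; apply: le_trans (ltW (uV n)).
  by apply: ereal_inf_lbound; exists n => /=.
by move/(le_trans (seqJ u ug u0)); rewrite leNgt rl.
Qed.

End end_filter_sequences.

(** * Measurability in [x] of the layer mass *)

Section layered_family.
Context {d : measure_display} {X : measurableType d} {R : realType}.
Variables (m : {measure set X -> \bar R}) (g : R) (Psi : X -> R -> R).
Hypothesis mPsi : measurable_fun (setT `*` `]0, +oo[%classic : set (X * R))
  (fun z : X * R => Psi z.1 z.2).
Notation mu := (@lebesgue_measure R).

Lemma measurable_fun_slice x : measurable_fun (`]0, +oo[%classic : set R) (Psi x).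
Proof.
have mD : measurable (setT `*` `]0, +oo[%classic : set (X * R)) by exact: measurableX.
have sub : pair x @` (`]0, +oo[%classic : set R) `<=`
    (setT `*` `]0, +oo[%classic : set (X * R)) by move=> _ [t t0 <-].
have mp : measurable_fun (`]0, +oo[%classic : set R) (@pair X R x).
  exact: measurable_funTS.
exact: (measurable_comp mD sub mPsi mp).
Qed.

(** Each layer is the section at [x] of one measurable set [E] in the product, so Tonelli applies to
    the integrand extended by 0 off [E]. *)
Lemma measurable_layer_integral c : measurable_fun setT
  (fun x => (\int[mu]_(t in powR_layer g c (Psi x)) (t `^ (g - 1))%:E)%E).
Proof.
pose E := [set z : X * R | 0 < z.2 /\ c * z.2 `^ g < Psi z.1 z.2].
have mE : measurable E.
  have mt : measurable_fun (setT `*` `]0, +oo[%classic : set (X * R))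
      (fun z : X * R => c * z.2 `^ g).
    apply: measurable_funM => //; apply: measurable_funTS.
    exact: (measurableT_comp (measurable_powR g) measurable_snd).
  have := @measurable_fun_ltr _ _ R _ _ _ mt mPsi.
  move=> /(_ (measurableX measurableT (measurable_itv _)) [set true] I).
  congr measurable; apply/seteqP; split => z /=; rewrite in_itv/= andbT.
    by move=> [[_ z0] ?].
  by move=> [z0 ?].
pose h := (fun z : X * R => (z.2 `^ (g - 1))%:E) \_ E.
have mh : measurable_fun setT h.
  apply: (measurable_restrictT _ mE).1; apply/measurable_EFinP; apply: measurable_funTS.
  exact: (measurableT_comp (measurable_powR (g - 1)) measurable_snd).
have h0 z : (0 <= h z)%E by rewrite /h patchE; case: ifP => // _; rewrite lee_fin powR_ge0.
have := @measurable_fun_fubini_tonelli_F _ _ X _ R mu h mh h0.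
apply: eq_measurable_fun => x _; rewrite /fubini_F [RHS]integral_mkcond.
by apply: eq_integral => t _; rewrite !patchE; congr (if _ then _ else _).
Qed.

Lemma measurable_layer_mass c : measurable_fun setT (fun x => layer_mass g c (Psi x)).
Proof. by apply: measurable_funeM; exact: measurable_layer_integral. Qed.

End layered_family.

(** * Bounds and limits for [Jfun] *)

Section limits_of_J.
Context {d : measure_display} {X : measurableType d} {R : realType}.
Variables (m : {measure set X -> \bar R}) (p gamma : R).
Variables (T : R -> (X -> R) -> X -> R) (f : X -> R).
Hypothesis p_gt0 : 0 < p.
Hypothesis gamma_neq0 : gamma != 0.
Hypothesis mT : measurable_fun (setT `*` `]0, +oo[%classic : set (X * R))
  (fun z : X * R => T z.2 f z.1).
Implicit Types (x : X) (t lam c : R) (g : X -> R).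

Let Psi x t : R := `|T t f x| `^ p.

Let mPsi : measurable_fun (setT `*` `]0, +oo[%classic : set (X * R))
  (fun z : X * R => Psi z.1 z.2).
Proof.
apply: (measurableT_comp (measurable_powR p)).
exact: (measurableT_comp (@normr_measurable R setT) mT).
Qed.

Let Psi0 x t : 0 <= Psi x t. Proof. exact: powR_ge0. Qed.

Lemma Jfun_layer_mass lam : 0 < lam ->
  Jfun m p gamma T f lam = (\int[m]_x layer_mass gamma (lam `^ p) (Psi x))%E.
Proof.
move=> lam0.
have layerE x : [set t | 0 < t /\ lam < t `^ (- (gamma / p)) * `|T t f x|]
    = powR_layer gamma (lam `^ p) (Psi x).
  by apply/seteqP; split => t [t0 H]; split => //; move: H; rewrite weighted_level_powR.
rewrite /Jfun; under eq_integral => x _ do rewrite layerE.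
have I0 x : [set: X] x -> (0 <= \int[lebesgue_measure]_(t in
    powR_layer gamma (lam `^ p) (Psi x)) (t `^ (gamma - 1))%:E)%E.
  by move=> _; apply: integral_ge0 => t _; rewrite lee_fin powR_ge0.
rewrite -(ge0_integralZl_EFin m measurableT I0 _ (powR_ge0 _ _))//.
exact: measurable_layer_integral.
Qed.

Let mpow (h : X -> \bar R) : measurable_fun setT h ->
  measurable_fun setT (fun x => poweR `|h x|%E p).
Proof.
move=> mh; have mabs : measurable_fun setT (abse \o h).
  exact: (measurableT_comp (@abse_measurable R setT) mh).
exact: (measurableT_comp (measurable_poweR p) mabs).
Qed.

Let mPoweR (h : X -> \bar R) : measurable_fun setT h ->
  measurable_fun setT (fun x => (`|gamma|^-1)%:E * poweR `|h x| p)%E.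
Proof. by move=> mh; apply: measurable_funeM; exact: mpow. Qed.

Lemma Lnorm_mass (h : X -> \bar R) : measurable_fun setT h ->
  ((`|gamma|^-1)%:E * poweR ('N[m]_p%:E[h]) p =
   \int[m]_x ((`|gamma|^-1)%:E * poweR `|h x| p))%E.
Proof.
move=> mh; rewrite poweR_Lnorm ?gt_eqF// ge0_integralZl_EFin//.
- by move=> x _; exact: poweR_ge0.
- exact: mpow.
Qed.

(** Where the maximal function is infinite the right side is [+oo], since [p] and [|gamma|^-1] are
    positive; elsewhere it bounds [Psi x] by a constant and [layer_mass_le_cst] applies. *)
Lemma layer_mass_le_Tstar x c : 0 < c ->
  (layer_mass gamma c (Psi x) <= (`|gamma|^-1)%:E * poweR `|Tstar T f x| p)%E.
Proof.
move=> c0; have k0 : 0 < `|gamma|^-1 by rewrite invr_gt0 normr_gt0.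
have T_le t : 0 < t -> ((`|T t f x|)%:E <= `|Tstar T f x|)%E.
  move=> t0; apply: le_trans (lee_abs _); apply: ereal_sup_ubound.
  by exists t => //=; rewrite in_itv/= t0.
case E : (Tstar T f x) T_le => [s| |] T_le; last 2 first.
- by rewrite poweRyr ?gt_eqF// gt0_muley ?leey ?lte_fin.
- by rewrite poweRyr ?gt_eqF// gt0_muley ?leey ?lte_fin.
rewrite poweR_EFin -EFinM; apply: layer_mass_le_cst => //.
- exact: measurable_fun_slice.
- move=> t t0; apply: ge0_ler_powR; rewrite ?nnegrE ?normr_ge0 ?(ltW p_gt0)//.
  by have := T_le t t0; rewrite lee_fin.
Qed.

Lemma Psi_cvg g x : T t f x @[t --> 0^'+] --> g x ->
  Psi x t @[t --> 0^'+] --> `|g x| `^ p.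
Proof.
by move=> /cvg_norm; apply: (cvg_powR_ge0 (a := fun t => `|T t f x|)).
Qed.

Lemma Jfun_le_Tstar lam : measurable_fun setT (Tstar T f : X -> \bar R) ->
  0 < lam ->
  (Jfun m p gamma T f lam <= (`|gamma|^-1)%:E * poweR ('N[m]_p%:E[Tstar T f]) p)%E.
Proof.
move=> mTs lam0; rewrite Jfun_layer_mass// Lnorm_mass//.
have c0 : 0 < lam `^ p by exact: powR_gt0.
apply: ge0_le_integral => //.
- by move=> x _; rewrite layer_mass_ge0// ltW.
- exact: measurable_layer_mass.
- exact: mPoweR.
- by move=> x _; exact: layer_mass_le_Tstar.
Qed.

Lemma limf_einf_Jfun g : measurable_fun setT g ->
  {ae m, forall x, T t f x @[t --> 0^'+] --> g x} ->
  ((`|gamma|^-1)%:E * poweR ('N[m]_p%:E[EFin \o g]) p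
     <= limf_einf (Jfun m p gamma T f) (end_filter gamma))%E.
Proof.
move=> mg Tg; apply: limf_einf_end_filter_seq => u ug u0.
have k0 : 0 < `|gamma|^-1 by rewrite invr_gt0 normr_gt0.
have c0 n : 0 < u n `^ p by exact: powR_gt0.
have cg : u n `^ p @[n --> \oo] --> end_filter gamma.
  exact: cvg_comp _ _ ug (cvg_powR_end_filter p_gt0).
have mEg : measurable_fun setT (EFin \o g) by exact/measurable_EFinP.
have -> : Jfun m p gamma T f \o u =
    fun n => (\int[m]_x layer_mass gamma (u n `^ p) (Psi x))%E.
  by apply/funext => n /=; rewrite Jfun_layer_mass.
rewrite Lnorm_mass//.
pose h n x := layer_mass gamma (u n `^ p) (Psi x).
have mh n : measurable_fun setT (h n) by exact: measurable_layer_mass.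
have h0 n x : (0 <= h n x)%E by rewrite layer_mass_ge0// ltW.
(* Fatou leaves an almost everywhere comparison of the limit mass with the lower limit of the layer
   masses. *)
apply: le_trans (fatou m measurableT mh (fun n x _ => h0 n x)).
apply: ae_ge0_le_integral => //.
- by move=> x _; rewrite mule_ge0 ?poweR_ge0// lee_fin ltW.
- exact: mPoweR.
- move=> x _; rewrite limn_einf_lim; apply: lime_ge; first exact: is_cvg_einfs.
  by apply: nearW => n; apply: le_ereal_inf_tmp => _ [k _ <-].
- rewrite /limn_einf; apply: measurableT_comp => //.
  by apply: measurable_fun_limn_esup => n; exact: measurableT_comp.
apply: filterS Tg => x Tgx _; rewrite poweR_EFin -EFinM.
(* Giving up [e] places all late terms above the target, hence also the infima of the late tails. *)
apply/lee_addgt0Pr => e e0; rewrite -leeBlDr// -EFinB.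
rewrite limn_einf_lim; apply: lime_ge; first exact: is_cvg_einfs.
have /cg[N _ hN] : \forall c \near end_filter gamma,
    ((`|gamma|^-1 * `|g x| `^ p - e)%:E <= layer_mass gamma c (Psi x))%E.
  apply: layer_mass_cvg_ge => //; last exact: Psi_cvg.
  exact: measurable_fun_slice.
exists N => // n Nn; apply: le_ereal_inf_tmp => _ [k nk <-]; apply: hN.
exact: leq_trans Nn nk.
Qed.

Lemma cvg_Jfun g :
  measurable_fun setT (Tstar T f : X -> \bar R) ->
  (\int[m]_x poweR `|Tstar T f x| p < +oo)%E ->
  measurable_fun setT g ->
  {ae m, forall x, T t f x @[t --> 0^'+] --> g x} ->
  Jfun m p gamma T f lam @[lam --> end_filter gamma] -->
    ((`|gamma|^-1)%:E * poweR ('N[m]_p%:E[EFin \o g]) p)%E.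
Proof.
move=> mTs iTs mg Tg; apply: cvg_end_filter_seq => u ug u0.
have k0 : 0 < `|gamma|^-1 by rewrite invr_gt0 normr_gt0.
have c0 n : 0 < u n `^ p by exact: powR_gt0.
have cg : u n `^ p @[n --> \oo] --> end_filter gamma.
  exact: cvg_comp _ _ ug (cvg_powR_end_filter p_gt0).
have mEg : measurable_fun setT (EFin \o g) by exact/measurable_EFinP.
have -> : (fun n => Jfun m p gamma T f (u n)) =
    fun n => (\int[m]_x layer_mass gamma (u n `^ p) (Psi x))%E.
  by apply/funext => n /=; rewrite Jfun_layer_mass.
rewrite Lnorm_mass//.
have iD : m.-integrable setT (fun x => (`|gamma|^-1)%:E * poweR `|Tstar T f x| p)%E.
  apply/integrableP; split; first exact: mPoweR.
  under eq_integral => x _ do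
    rewrite gee0_abs ?mule_ge0 ?poweR_ge0 ?lee_fin ?(ltW k0)//.
  rewrite -Lnorm_mass// poweR_Lnorm ?gt_eqF//.
  by rewrite lte_mul_pinfty ?lee_fin ?(ltW k0).
(* The dominating function is $(T^*f)^p/|\gamma|$, which bounds every layer mass whatever the
   level. *)
have [|||||_ _] := @dominated_convergence _ X R m setT measurableT
  (fun n x => layer_mass gamma (u n `^ p) (Psi x))
  (fun x => (`|gamma|^-1)%:E * poweR `|(EFin \o g) x| p)%E
  (fun x => (`|gamma|^-1)%:E * poweR `|Tstar T f x| p)%E.
- by move=> n; exact: measurable_layer_mass.
- exact: mPoweR.
- have fin := integrable_ae measurableT iD.
  apply: filterS2 Tg fin => x Tgx /(_ I) finx _.
  have -> : ((`|gamma|^-1)%:E * poweR `|(EFin \o g) x| p)%E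
      = (`|gamma|^-1 * `|g x| `^ p)%:E by rewrite EFinM -poweR_EFin.
  suff H : layer_mass gamma c (Psi x) @[c --> end_filter gamma] -->
      (`|gamma|^-1 * `|g x| `^ p)%:E by exact: cvg_comp _ _ cg H.
  (* Integrability makes the maximal function finite almost everywhere; its value provides the bound
     in [t] that [layer_mass_cvg] requires. *)
  have [M TsM] : exists M, `|Tstar T f x|%E = M%:E.
    move: finx; case: (Tstar T f x) => [s| |]; first by exists `|s|.
    + by rewrite poweRyr ?gt_eqF// gt0_muley ?lte_fin.
    + by rewrite poweRyr ?gt_eqF// gt0_muley ?lte_fin.
  apply: (@layer_mass_cvg _ _ _ _ (M `^ p)) => //.
  + exact: measurable_fun_slice.
  + move=> t t0; rewrite Psi0/=.
    have TM : `|T t f x| <= M.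
      rewrite -lee_fin -TsM; apply: le_trans (lee_abs _); apply: ereal_sup_ubound.
      by exists t => //=; rewrite in_itv/= t0.
    by apply: ge0_ler_powR; rewrite ?nnegrE ?(ltW p_gt0)// (le_trans _ TM).
  + exact: Psi_cvg.
- exact: iD.
- apply: aeW => x n _; rewrite (gee0_abs (layer_mass_ge0 _ _ (ltW (c0 n)))).
  exact: layer_mass_le_Tstar.
- by [].
Qed.

End limits_of_J.

Unset Implicit Arguments.

Theorem mainTheorem17 (d : measure_display) (X : measurableType d) (R : realType)
  (m : {measure set X -> \bar R}) (p gamma : R)
  (T : R -> (X -> R) -> X -> R) (f : X -> R) :
  sigma_finite setT m ->
  1 <= p -> gamma != 0 ->
  inLp m p f ->
  (forall t : R, 0 < t -> inLp m p (T t f)) ->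
  measurable_fun (setT `*` `]0, +oo[%classic : set (X * R)) (fun z : X * R => T z.2 f z.1) ->
  let Lfilt : set_system R := if 0 < gamma then +oo%R else 0^'+ in
  (* (i) *)
  ((measurable_fun setT (Tstar T f : X -> \bar R) /\
    (\int[m]_x poweR `|Tstar T f x| p < +oo)%E) ->
     (ereal_sup [set Jfun m p gamma T f lam | lam in [set lam : R | (0 < lam)%R]]
        <= (`|gamma|^-1)%:E * poweR ('N[m]_p%:E[Tstar T f]) p)%E /\
     (forall g : X -> R, measurable_fun setT g ->
        {ae m, forall x, T t f x @[t --> 0^'+] --> g x} ->
        Jfun m p gamma T f @ Lfilt
          --> ((`|gamma|^-1)%:E * poweR ('N[m]_p%:E[EFin \o g]) p)%E)) /\
  (* (ii) *)
  (forall g : X -> R, measurable_fun setT g ->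
     {ae m, forall x, T t f x @[t --> 0^'+] --> g x} ->
     ((`|gamma|^-1)%:E * poweR ('N[m]_p%:E[EFin \o g]) p
        <= limf_einf (Jfun m p gamma T f) Lfilt)%E).
Proof.
move=> _ p1 g0 _ _ mT Lfilt.
have p0 : 0 < p by exact: lt_le_trans p1.
split; last by move=> g mg Tg; exact: limf_einf_Jfun.
move=> [mTs iTs]; split; last by move=> g mg Tg; exact: cvg_Jfun.
apply: ge_ereal_sup => _ [lam lam0 <-]; exact: Jfun_le_Tstar.
Qed.
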